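(* For $d\ge 1$ let $r_{n,k_1,\ldots,k_d}$ be the number of random Apollonian network structures $R$ of order $n$ having, for each $1\le j\le d$, exactly $k_j$ internal vertices at graph distance $j$ from $O_1(R)$. Then $r_{n,k_1,\ldots,k_d}$ is the coefficient of $u_1^{k_1}u_2^{k_2}\cdots u_d^{k_d}z^n$ in the multivariate formal power series $T_d(z,u_1,\ldots,u_d)$, where the series $T_d$ satisfy the recurrence relations $$T_1(z,u_1)=1+z u_1\,T_1^2(z,u_1)\,T_0(z),\qquad T_0(z)=T(z),$$ and, for $d\ge 2$, $$T_d(z,u_1,\ldots,u_d)=1+z u_1\,T_d^2(z,u_1,\ldots,u_d)\left(1+z u_2\,\frac{1}{\bigl(1-z u_2\,T_{d-1}^2(z,u_2,\ldots,u_d)\bigr)^3}\right).$$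
   Context: $T(z)=\sum_n T_n z^n$ is the generating function of plane ternary trees counted by internal nodes, i.e. the formal power series satisfying $T(z)=1+zT^3(z)$. A random Apollonian network structure (RANS) $R$ is defined recursively: it is either an empty triangle with ordered vertices $O_1(R),O_2(R),O_3(R)$ (mutually adjacent), or such a triangle together with a new vertex $c$ (the center of $R$) placed inside and joined to $O_1,O_2,O_3$, each of the three resulting sub-triangles being substituted by a RANS. The sub-RANS are $S_1(R),S_2(R),S_3(R)$, where $S_i(R)$ is the one whose triangle does not contain $O_i(R)$; the $i$-th outermost vertex of $S_i(R)$ is $c$ and its other outermost vertices are $O_j(R)$ in position $j$, $j\neq i$. The vertices $O_1(R),O_2(R),O_3(R)$ are the outermost vertices; all other vertices are internal. The order of the empty RANS is $0$, and the order of a non-empty RANS is one plus the sum of the orders of its three sub-RANS (so it is the number of internal vertices). RANS of order $n$ are in bijection with plane ternary trees with $n$ internal nodes. *)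

(* Defs.v *)
From HB Require Import structures.
From mathcomp Require Import all_boot all_order all_algebra.
From mathcomp Require Import boolp.
From mathcomp Require Import mpoly.

Set Implicit Arguments.
Unset Strict Implicit.
Unset Printing Implicit Defensive.

Import GRing.Theory.
Local Open Scope ring_scope.

Record mseries (R : Type) (n : nat) :=
  MSeries { mscoef : 'X_{1..n} -> R }.

HB.instance Definition _ R n := gen_eqMixin (mseries R n).
HB.instance Definition _ R n := gen_choiceMixin (mseries R n).

Lemma mseriesP R n (f g : mseries R n) : mscoef f =1 mscoef g -> f = g.
Proof. by case: f => f; case: g => g /= /funext ->. Qed.

Section MSeriesZmod.
Variables (R : zmodType) (n : nat).
Implicit Types f g : mseries R n.

Definition ms_zero : mseries R n := MSeries (fun=> 0).
Definition ms_opp f : mseries R n := MSeries (fun m => - mscoef f m).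
Definition ms_add f g : mseries R n :=
  MSeries (fun m => mscoef f m + mscoef g m).

Lemma ms_addA : associative ms_add.
Proof. by move=> f g h; apply: mseriesP => m /=; rewrite addrA. Qed.
Lemma ms_addC : commutative ms_add.
Proof. by move=> f g; apply: mseriesP => m /=; rewrite addrC. Qed.
Lemma ms_add0 : left_id ms_zero ms_add.
Proof. by move=> f; apply: mseriesP => m /=; rewrite add0r. Qed.
Lemma ms_addN : left_inverse ms_zero ms_opp ms_add.
Proof. by move=> f; apply: mseriesP => m /=; rewrite addNr. Qed.

HB.instance Definition _ :=
  GRing.isZmodule.Build (mseries R n) ms_addA ms_addC ms_add0 ms_addN.

Lemma mscoef0 m : mscoef (0 : mseries R n) m = 0. Proof. by []. Qed.
Lemma mscoefD f g m : mscoef (f + g) m = mscoef f m + mscoef g m.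
Proof. by []. Qed.
Lemma mscoefN f m : mscoef (- f) m = - mscoef f m.
Proof. by []. Qed.
End MSeriesZmod.

Section MSeriesRing.
Variables (R : comNzRingType) (n : nat).
Implicit Types (f g h : mseries R n) (p q : {mpoly R[n]}) (m : 'X_{1..n}).

Definition ms_one : mseries R n := MSeries (fun m => (m == 0%MM)%:R).

Definition ms_mul f g : mseries R n :=
  MSeries (fun m =>
    \sum_(k : 'X_{1..n < (mdeg m).+1, (mdeg m).+1} | m == (k.1 + k.2)%MM)
      mscoef f k.1 * mscoef g k.2).

(* The ring laws are transported from polynomials: up to any given total
   degree, a series coincides with a polynomial. *)
Definition agree (N : nat) f p :=
  forall m, (mdeg m < N)%N -> mscoef f m = p@_m.

Definition ms_trunc N f : {mpoly R[n]} :=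
  \sum_(m : 'X_{1..n < N}) mscoef f m *: 'X_[m].

Lemma agree_trunc N f : agree N f (ms_trunc N f).
Proof. by move=> m ltm; rewrite mcoeff_mpoly. Qed.

Lemma agree1 N : agree N ms_one 1.
Proof. by move=> m _; rewrite mcoeff1. Qed.

Lemma agreeD N f g p q :
  agree N f p -> agree N g q -> agree N (f + g) (p + q).
Proof. by move=> fp gq m ltm; rewrite mcoeffD mscoefD fp // gq. Qed.

Lemma agreeM N f g p q :
  agree N f p -> agree N g q -> agree N (ms_mul f g) (p * q).
Proof.
move=> fp gq m ltm; rewrite mcoeffM; apply: eq_bigr => -[k1 k2] /= _.
by rewrite fp ?gq // (leq_trans (bmdeg _)).
Qed.

Lemma agree_eq f g :
  (forall N, exists2 p, agree N f p & agree N g p) -> f = g.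
Proof.
move=> H; apply: mseriesP => m.
by have [p fp gp] := H (mdeg m).+1; rewrite fp // gp.
Qed.

Lemma ms_mulA : associative ms_mul.
Proof.
move=> f g h; apply: agree_eq => N.
exists (ms_trunc N f * (ms_trunc N g * ms_trunc N h)); last rewrite mulrA;
  by do ?apply: agreeM; apply: agree_trunc.
Qed.

Lemma ms_mulC : commutative ms_mul.
Proof.
move=> f g; apply: agree_eq => N.
exists (ms_trunc N f * ms_trunc N g); last rewrite mulrC;
  by do ?apply: agreeM; apply: agree_trunc.
Qed.

Lemma ms_mul1 : left_id ms_one ms_mul.
Proof.
move=> f; apply: agree_eq => N; exists (1 * ms_trunc N f).
  by apply: agreeM; [apply: agree1 | apply: agree_trunc].
by rewrite mul1r; apply: agree_trunc.
Qed.

Lemma ms_mulDl : left_distributive ms_mul +%R.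
Proof.
move=> f g h; apply: agree_eq => N.
exists ((ms_trunc N f + ms_trunc N g) * ms_trunc N h).
  by apply: agreeM; [apply: agreeD|]; apply: agree_trunc.
by rewrite mulrDl; apply: agreeD; apply: agreeM; apply: agree_trunc.
Qed.

Lemma ms_oner_neq0 : ms_one != 0.
Proof.
by apply/eqP => /(congr1 (fun f => mscoef f 0%MM)) /eqP /=;
  rewrite eqxx oner_eq0.
Qed.

HB.instance Definition _ := GRing.Zmodule_isComNzRing.Build (mseries R n)
  ms_mulA ms_mulC ms_mul1 ms_mulDl ms_oner_neq0.

Lemma mscoef1 m : mscoef (1 : mseries R n) m = (m == 0%MM)%:R.
Proof. by []. Qed.

Lemma mscoefM f g m :
  mscoef (f * g) m =
  \sum_(k : 'X_{1..n < (mdeg m).+1, (mdeg m).+1} | m == (k.1 + k.2)%MM)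
      mscoef f k.1 * mscoef g k.2.
Proof. by []. Qed.

Lemma mscoefM0 f g : mscoef (f * g) 0%MM = mscoef f 0%MM * mscoef g 0%MM.
Proof.
have lt0 : (mdeg (0%MM : 'X_{1..n}) < 1)%N by rewrite mdeg0.
have af := @agree_trunc 1 f; have ag := @agree_trunc 1 g.
rewrite (agreeM af ag lt0) (af _ lt0) (ag _ lt0).
exact: (rmorphM (mcoeff 0)).
Qed.

Lemma mscoef_eqM N f1 f2 g1 g2 :
    (forall m, (mdeg m < N)%N -> mscoef f1 m = mscoef f2 m) ->
    (forall m, (mdeg m < N)%N -> mscoef g1 m = mscoef g2 m) ->
  forall m, (mdeg m < N)%N -> mscoef (f1 * g1) m = mscoef (f2 * g2) m.
Proof.
move=> ef eg m ltm; rewrite !mscoefM; apply: eq_bigr => -[k1 k2] /= _.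
by rewrite ef ?eg // (leq_trans (bmdeg _)).
Qed.

Definition msC (c : R) : mseries R n := MSeries (fun m => c *+ (m == 0%MM)).

Definition msX (i : 'I_n) : mseries R n := MSeries (fun m => (m == U_(i)%MM)%:R).

Lemma mscoefX_small h k m : mscoef h 0%MM = 0 -> (mdeg m < k)%N ->
  mscoef (h ^+ k) m = 0.
Proof.
move=> h0; elim: k m => // k IH m; rewrite ltnS => lem.
rewrite exprS mscoefM big1 // => -[[k1 _] [k2 _]] /= /eqP em.
have [z1|nz1] := eqVneq k1 0%MM; first by rewrite z1 h0 mul0r.
rewrite IH ?mulr0 //; apply: leq_trans lem.
by rewrite em mdegD -[X in (X < _)%N]add0n ltn_add2r lt0n mdeg_eq0.
Qed.

End MSeriesRing.

Arguments msC {R n}.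
Arguments msX {R n}.

Section MSeriesUnit.
Variables (R : comUnitRingType) (n : nat).
Implicit Types (f g h : mseries R n) (m : 'X_{1..n}).

Definition ms_unit : pred (mseries R n) :=
  fun f => mscoef f 0%MM \is a GRing.unit.

(* With c the constant coefficient of f, the inverse of f is
   c^-1 * \sum_k (1 - c^-1 f)^k; the terms k > deg m vanish at m. *)
Definition ms_inv f : mseries R n :=
  if mscoef f 0%MM \is a GRing.unit then
    let c := msC (mscoef f 0%MM)^-1 in
    MSeries (fun m =>
      mscoef (c * \sum_(k < (mdeg m).+1) (1 - c * f) ^+ k) m)
  else f.

Lemma ms_mulV : {in ms_unit, left_inverse 1 ms_inv *%R}.
Proof.
move=> f; rewrite unfold_in /ms_inv => uf; rewrite uf.
set c := msC _; apply: mseriesP => m.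
set h := 1 - c * f.
have h0 : mscoef h 0%MM = 0.
  by rewrite /h mscoefD mscoefN mscoefM0 mscoef1 /= eqxx mulr1n mulVr ?subrr.
pose G N := \sum_(k < N) h ^+ k.
have Gstab k N m1 : (mdeg m1 < k <= N)%N -> mscoef (G N) m1 = mscoef (G k) m1.
  case/andP => ltk; elim: N => [|N IH]; first by case: k ltk.
  rewrite leq_eqVlt => /predU1P[-> //|]; rewrite ltnS => leN.
  rewrite [G _](big_ord_recr _ _ : _ = G N + h ^+ N).
  rewrite mscoefD IH // mscoefX_small ?addr0 //.
  exact: leq_trans leN.
set N := (mdeg m).+1.
transitivity (mscoef (c * G N * f) m).
  apply: (@mscoef_eqM _ _ N) => // m1 lt1.
  transitivity (mscoef (c * G (mdeg m1).+1) m1) => //.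
  apply: (@mscoef_eqM _ _ (mdeg m1).+1) => // m2 lt2.
  by rewrite (Gstab (mdeg m1).+1) // lt2 lt1.
rewrite -mulrA mulrCA mulrC.
have -> : c * f = 1 - h by rewrite /h opprB addrC subrK.
have -> : (1 - h) * G N = 1 - h ^+ N.
  rewrite -[in RHS](expr1n _ N) subrXX; congr (_ * _).
  by apply: eq_bigr => i _; rewrite expr1n mul1r.
by rewrite mscoefD mscoefN mscoefX_small ?subr0.
Qed.

Lemma ms_unitPl f g : g * f = 1 -> ms_unit f.
Proof.
move=> /(congr1 (fun f => mscoef f 0%MM)); rewrite mscoefM0 mscoef1 eqxx => e.
by apply/unitrP; exists (mscoef g 0%MM); split; rewrite // mulrC.
Qed.

Lemma ms_inv_out : {in [predC ms_unit], ms_inv =1 id}.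
Proof.
by move=> f; rewrite inE unfold_in /ms_inv => /negbTE ->.
Qed.

HB.instance Definition _ := GRing.ComNzRing_hasMulInverse.Build (mseries R n)
  ms_mulV ms_unitPl ms_inv_out.

End MSeriesUnit.

(* The series f(X_0, ..., X_(h-1), X_(h+1), ..., X_n), in the n + 1 variables
   X_0, ..., X_n. *)
Definition ms_skip (R : nmodType) n (h : 'I_n.+1) (f : mseries R n) :
    mseries R n.+1 :=
  MSeries (fun m =>
    if m h == 0%N then mscoef f [multinom m (lift h i) | i < n] else 0).

Section Distance.
Variables (V : finType) (e : rel V).

Definition walk (l : nat) (x y : V) : bool :=
  [exists p : l.-tuple V, path e x p && (last x p == y)].

Definition at_distance (l : nat) (x y : V) : bool :=
  walk l x y && [forall i : 'I_l, ~~ walk i x y].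

End Distance.

(* [RNode R1 R2 R3] is the structure whose sub-RANS S_1, S_2, S_3 are R1, R2,
   R3. *)
Inductive rans : Type :=
  | REmpty
  | RNode of rans & rans & rans.

Fixpoint rans_order (R : rans) : nat :=
  if R is RNode R1 R2 R3
  then (rans_order R1 + rans_order R2 + rans_order R3).+1 else 0%N.

(* In a non-empty structure, [None] is the center. *)
Fixpoint internal (R : rans) : finType :=
  if R is RNode R1 R2 R3 then option (internal R1 + internal R2 + internal R3)
  else void.

(* [inl i] is the (i+1)-th outermost vertex. *)
Definition vertex (R : rans) : finType := ('I_3 + internal R)%type.

Definition O1 (R : rans) : vertex R := inl ord0.

(* The (i+1)-th sub-RANS sits in R with its (i+1)-th outermost vertex at the
   center c of R, and its two other ones at those of R with the same index. *)
Definition place (i : 'I_3) (S R : finType) (c : R) (f : S -> R)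
    (v : 'I_3 + S) : 'I_3 + R :=
  match v with
  | inl j => if j == i then inr c else inl j
  | inr s => inr (f s)
  end.

Section Place.
Variables R1 R2 R3 : rans.
Let R := RNode R1 R2 R3.

Definition place1 : vertex R1 -> vertex R :=
  @place (inord 0) (internal R1) (internal R) None (fun s => Some (inl (inl s))).
Definition place2 : vertex R2 -> vertex R :=
  @place (inord 1) (internal R2) (internal R) None (fun s => Some (inl (inr s))).
Definition place3 : vertex R3 -> vertex R :=
  @place (inord 2) (internal R3) (internal R) None (fun s => Some (inr s)).
End Place.

(* The sides of the outer triangle and the edges from the center to its
   vertices are sides of the triangles of the three sub-RANS, so the edges of
   a non-empty structure are those of its sub-RANS. *)
Fixpoint adj (R : rans) : rel (vertex R) :=
  match R return rel (vertex R) with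
  | REmpty => fun u v => u != v
  | RNode R1 R2 R3 => fun u v =>
    [|| [exists a, exists b,
           [&& @adj R1 a b, place1 R2 R3 a == u & place1 R2 R3 b == v]],
        [exists a, exists b,
           [&& @adj R2 a b, place2 R1 R3 a == u & place2 R1 R3 b == v]]
      | [exists a, exists b,
           [&& @adj R3 a b, place3 R1 R2 a == u & place3 R1 R2 b == v]]]
  end.

Lemma adj_outer R (i j : 'I_3) : @adj R (inl i) (inl j) = (i != j).
Proof.
elim: R i j => [//|R1 IH1 R2 IH2 R3 IH3] i j /=.
apply/idP/idP.
  case/or3P => /existsP[a /existsP[b /and3P[]]];
    case: a => [a|a]; case: b => [b|b] //=; case: ifP => // _;
    rewrite ?(IH1, IH2, IH3) //; case: ifP => // _ ab /eqP[<-] /eqP[<-] //.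
move=> ij; have [k ki kj] : exists2 k : 'I_3, i != k & j != k.
  case: (pickP (fun k : 'I_3 => (i != k) && (j != k))) => [k /andP[]|none].
    by exists k.
  have : (#|[set i; j]| < 3)%N by rewrite cards2 ij.
  suff -> : [set i; j] = setT by rewrite cardsT card_ord.
  apply/setP => k; rewrite !inE; have := none k.
  by rewrite -negb_or ![k == _]eq_sym => /negbFE.
have [ek|ek|ek] : [\/ k = inord 0, k = inord 1 | k = inord 2].
  by case: k {ki kj} => -[|[|[|//]]] ltk;
    [constructor 1 | constructor 2 | constructor 3];
    apply: val_inj; rewrite /= inordK.
- apply/or3P; apply: Or31; apply/existsP; exists (inl i); apply/existsP.
  by exists (inl j); rewrite IH1 ij /= -ek (negbTE ki) (negbTE kj) !eqxx.
- apply/or3P; apply: Or32; apply/existsP; exists (inl i); apply/existsP.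
  by exists (inl j); rewrite IH2 ij /= -ek (negbTE ki) (negbTE kj) !eqxx.
- apply/or3P; apply: Or33; apply/existsP; exists (inl i); apply/existsP.
  by exists (inl j); rewrite IH3 ij /= -ek (negbTE ki) (negbTE kj) !eqxx.
Qed.

Fixpoint rans_code (R : rans) : GenTree.tree unit :=
  if R is RNode R1 R2 R3
  then GenTree.Node 0 [:: rans_code R1; rans_code R2; rans_code R3]
  else GenTree.Node 0 [::].

Fixpoint rans_decode (t : GenTree.tree unit) : rans :=
  if t is GenTree.Node _ [:: t1; t2; t3]
  then RNode (rans_decode t1) (rans_decode t2) (rans_decode t3)
  else REmpty.

Lemma rans_codeK : cancel rans_code rans_decode.
Proof. by elim=> //= R1 -> R2 -> R3 ->. Qed.

HB.instance Definition _ := Countable.copy rans (can_type rans_codeK).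

Record rans_of (n : nat) :=
  RansOf { rans_val :> rans; _ : rans_order rans_val == n }.

HB.instance Definition _ n := [isSub for @rans_val n].
HB.instance Definition _ n := [Countable of rans_of n by <:].

Fixpoint rans_upto (n : nat) : seq rans :=
  if n is n'.+1 then
    REmpty :: [seq RNode p.1 p.2 R3
      | p <- [seq (R1, R2) | R1 <- rans_upto n', R2 <- rans_upto n'],
        R3 <- rans_upto n']
  else [:: REmpty].

Lemma mem_rans_upto n R : (rans_order R <= n)%N -> R \in rans_upto n.
Proof.
elim: n R => [|n IH] [|R1 R2 R3] //= le_n; rewrite inE /=.
have [le1 le2 le3] :
    [/\ rans_order R1 <= n, rans_order R2 <= n & rans_order R3 <= n]%N.
  move: le_n; rewrite ltnS => le_n.
  split; apply: leq_trans le_n.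
  - by rewrite -addnA leq_addr.
  - by rewrite addnAC leq_addl.
  - by rewrite leq_addl.
apply/orP; right; apply/allpairsP; exists ((R1, R2), R3); split; rewrite ?IH //=.
by apply/allpairsP; exists (R1, R2); split; rewrite ?IH.
Qed.

Section RansFinite.
Variable n : nat.
Let to_sub (R : rans_of n) : seq_sub (rans_upto n) :=
  SeqSub (mem_rans_upto (eq_leq (eqP (valP R)))).
Let of_sub (s : seq_sub (rans_upto n)) : option (rans_of n) := insub (val s).
Lemma rans_of_pcan : pcancel to_sub of_sub.
Proof. by move=> R; rewrite /of_sub /= valK. Qed.
HB.instance Definition _ := isFinite.Build (rans_of n) (pcan_enumP rans_of_pcan).
End RansFinite.

(* The number r_(n,k_1,...,k_d). *)
Definition rans_count (n d : nat) (k : d.-tuple nat) : nat :=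
  #|[set R : rans_of n | [forall j : 'I_d,
      #|[set v : internal R | at_distance (@adj R) j.+1 (O1 R) (inr v)]|
      == tnth k j]]|.

(* A family (T_d)_d, where T_d is a series in the d + 1 variables
   X_0 = z, X_1 = u_1, ..., X_d = u_d. *)
Definition zvar {d} : mseries int d.+1 := msX ord0.
Definition uvar {d} (j : nat) : mseries int d.+1 := msX (inord j).

(* T_d(z, u_2, ..., u_(d+1)) as a series in z, u_1, ..., u_(d+1). *)
Definition shift_u d (f : mseries int d.+1) : mseries int d.+2 :=
  ms_skip (inord 1) f.

(* The first equation determines T_0 = T(z). In the last one, the inverted
   series has constant coefficient 1, so it is a unit. *)
Definition apollonian_system (T : forall d, mseries int d.+1) : Prop :=
  [/\ T 0 = 1 + zvar * T 0 ^+ 3,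
      T 1 = 1 + zvar * uvar 1 * T 1 ^+ 2 * shift_u (T 0)
    & forall d,
      T d.+2 = 1 + zvar * uvar 1 * T d.+2 ^+ 2 *
        (1 + zvar * uvar 2 *
           (1 / (1 - zvar * uvar 2 * shift_u (T d.+1) ^+ 2) ^+ 3))].

(* Main.v *)
Require Import Defs.
From mathcomp Require Import all_boot all_order all_algebra.
From mathcomp Require Import mpoly.
From mathcomp Require Import ring zify.

(** The distance of an internal vertex to [O1] depends on the rest of the
    structure only through the distances of the three corners of the
    sub-triangle that contains it. So let a source see a triangle whose corners
    are at distances [a], [b], [c], any two of which differ by at most one: the
    center is at distance [x = 1 + min(a, b, c)], and the three sub-triangles
    are labelled [(x, b, c)], [(a, x, c)] and [(a, b, x)]. These labels, defined
    by structural recursion ([idist]), are the graph distances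
    ([at_distance_O1]): along an edge they change by at most one, because each
    edge is a side of a triangle with such labels, and each internal vertex has
    a neighbour labelled one less.

    Let [G(a, b, c)], here [gser d a b c], count the structures by order and by
    the number of internal vertices with each label in [1..d]. Decomposing a
    structure at its center gives ([gser_rec])
      [G(a, b, c) = 1 + z u_x G(x, b, c) G(a, x, c) G(a, b, x)],
    where [u_x] is read as 1 for [x > d]. The series [G] is symmetric in
    [a], [b], [c] ([gserC], [gserAC]), and adding 1 to all labels shifts the
    variables [u_j] ([gser_shift]). With [T_d = G(0, 1, 1)], the case [d = 1]
    reads [T_1 = 1 + z u_1 T_1^2 G(1, 1, 1)], where [G(1, 1, 1)] only counts by
    order. For [d >= 2], let [C = G(1, 2, 2)], the shift of [T_(d-1)]; then
      [T_d = 1 + z u_1 T_d^2 G(1, 1, 1)],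
      [G(1, 1, 1) = 1 + z u_2 G(2, 1, 1)^3],
      [G(2, 1, 1) = 1 + z u_2 G(2, 1, 1) C^2],
    and the last equation is solved by [G(2, 1, 1) = 1 / (1 - z u_2 C^2)], which
    yields the stated recurrence ([gser_system]).

    Conversely, each equation of the system reads [T = 1 + z F(T)], so that the
    coefficients of [T] of degree at most [N] determine those of degree at most
    [N + 1]: the solution is unique ([apollonian_system_unique]), and its
    coefficients are those of [G(0, 1, 1)] ([rans_count_gser]). *)

Set Implicit Arguments.
Unset Strict Implicit.
Unset Printing Implicit Defensive.

Import GRing.Theory.
Local Open Scope ring_scope.

(** * Graph distances from one vertex *)

Section DistanceFunction.
Variables (V : finType) (e : rel V) (x0 : V) (f : V -> nat).
Hypothesis f0 : f x0 = 0%N.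
Hypothesis f_lip : forall u v, e u v -> (f v <= (f u).+1)%N.
Hypothesis f_pred : forall v, v != x0 -> exists2 u, e u v & f v = (f u).+1.

Lemma potential_le_walk l v : walk e l x0 v -> (f v <= l)%N.
Proof.
case/existsP => p /andP[ep /eqP <-].
suff H (s : seq V) y : path e y s -> (f (last y s) <= f y + size s)%N.
  by have := H p x0 ep; rewrite f0 size_tuple.
elim: s y => [|z s IH] y /=; first by rewrite addn0.
case/andP => /f_lip le_z /IH le_s; apply: leq_trans le_s _.
by rewrite addnS -addSn leq_add2r.
Qed.

Lemma walk_descent v : walk e (f v) x0 v.
Proof.
suff: forall l w, f w = l -> walk e l x0 w by apply.
elim=> {v} [|l IH] v fv.
  have [->|/f_pred[u _]] := eqVneq v x0; last by rewrite fv.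
  by apply/existsP; exists [tuple]; rewrite /= eqxx.
have vx0 : v != x0 by apply: contra_eq_neq fv => ->; rewrite f0.
have [u euv] := f_pred vx0; rewrite fv => -[/esym/IH].
case/existsP => p /andP[ep /eqP lu].
apply/existsP; exists [tuple of rcons p v].
by rewrite /= rcons_path last_rcons ep lu euv eqxx.
Qed.

(** A potential that is 1-Lipschitz along edges is a lower bound for the length
    of walks; if moreover it can be lowered by one step from every other
    vertex, following such steps realises the bound. *)
Lemma at_distanceE l v : at_distance e l x0 v = (f v == l).
Proof.
apply/idP/eqP => [/andP[wl /forallP short]|<-].
  apply/eqP; rewrite eqn_leq potential_le_walk //= leqNgt; apply/negP => lt_fl.
  by have := short (Ordinal lt_fl); rewrite walk_descent.
rewrite /at_distance walk_descent; apply/forallP => i; apply/negP.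
by move/potential_le_walk; rewrite leqNgt ltn_ord.
Qed.

End DistanceFunction.

(** * Distances in a random Apollonian network structure *)

Definition center_label (a b c : nat) : nat := (minn a (minn b c)).+1.

(** The distances of the internal vertices to a source that reaches the
    structure through its outermost vertices, themselves at distances
    [a], [b], [c] of the source. *)
Fixpoint idist (R : rans) (a b c : nat) : internal R -> nat :=
  match R return internal R -> nat with
  | REmpty => fun=> 0%N
  | RNode R1 R2 R3 => fun v =>
    let x := center_label a b c in
    match v with
    | None => x
    | Some (inl (inl s)) => @idist R1 x b c s
    | Some (inl (inr s)) => @idist R2 a x c s
    | Some (inr s) => @idist R3 a b x s
    end
  end.

Definition vdist (R : rans) (a b c : nat) (v : vertex R) : nat :=
  match v with
  | inl i => nth 0%N [:: a; b; c] i
  | inr s => idist a b c s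
  end.

Lemma ord3_cases (i : 'I_3) : [\/ i = inord 0, i = inord 1 | i = inord 2].
Proof.
case: i => -[|[|[|//]]] lti;
  [constructor 1 | constructor 2 | constructor 3];
  by apply: val_inj; rewrite /= inordK.
Qed.

Section VdistPlace.
Variables (R1 R2 R3 : rans) (a b c : nat).
Let x := center_label a b c.
Let R := RNode R1 R2 R3.

Lemma vdist_place1 (v : vertex R1) :
  vdist a b c (place1 R2 R3 v) = vdist x b c v.
Proof.
case: v => // i.
by case: (ord3_cases i) => ->; rewrite /= -val_eqE /= !inordK //= inordK.
Qed.

Lemma vdist_place2 (v : vertex R2) :
  vdist a b c (place2 R1 R3 v) = vdist a x c v.
Proof.
case: v => // i.
by case: (ord3_cases i) => ->; rewrite /= -val_eqE /= !inordK //= inordK.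
Qed.

Lemma vdist_place3 (v : vertex R3) :
  vdist a b c (place3 R1 R2 v) = vdist a b x v.
Proof.
case: v => // i.
by case: (ord3_cases i) => ->; rewrite /= -val_eqE /= !inordK //= inordK.
Qed.

Lemma adj_place1 (u v : vertex R1) :
  adj u v -> @adj R (place1 R2 R3 u) (place1 R2 R3 v).
Proof.
move=> uv /=; apply/or3P; constructor 1.
by apply/existsP; exists u; apply/existsP; exists v; rewrite uv !eqxx.
Qed.

Lemma adj_place2 (u v : vertex R2) :
  adj u v -> @adj R (place2 R1 R3 u) (place2 R1 R3 v).
Proof.
move=> uv /=; apply/or3P; constructor 2.
by apply/existsP; exists u; apply/existsP; exists v; rewrite uv !eqxx.
Qed.

Lemma adj_place3 (u v : vertex R3) :
  adj u v -> @adj R (place3 R1 R2 u) (place3 R1 R2 v).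
Proof.
move=> uv /=; apply/or3P; constructor 3.
by apply/existsP; exists u; apply/existsP; exists v; rewrite uv !eqxx.
Qed.

(** Each outermost vertex is an outermost vertex of a sub-RANS that has the
    center as another one. *)
Lemma adj_center (i : 'I_3) : @adj R (inl i) (inr None).
Proof.
have [->|->|->] := ord3_cases i.
- have /adj_place2 : @adj R2 (inl (inord 0)) (inl (inord 1)).
    by rewrite adj_outer -val_eqE /= !inordK.
  by rewrite /place2 /= -!val_eqE /= !inordK //.
- have /adj_place1 : @adj R1 (inl (inord 1)) (inl (inord 0)).
    by rewrite adj_outer -val_eqE /= !inordK.
  by rewrite /place1 /= -!val_eqE /= !inordK //.
- have /adj_place1 : @adj R1 (inl (inord 2)) (inl (inord 0)).
    by rewrite adj_outer -val_eqE /= !inordK.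
  by rewrite /place1 /= -!val_eqE /= !inordK //.
Qed.

End VdistPlace.

Definition within_one (a b c : nat) : bool :=
  (maxn a (maxn b c) <= center_label a b c)%N.

(** Labels that differ pairwise by at most one keep this property in the three
    sub-triangles, and every edge is a side of some triangle. *)
Lemma vdist_lip (R : rans) a b c : within_one a b c ->
  forall u v : vertex R, adj u v -> (vdist a b c v <= (vdist a b c u).+1)%N.
Proof.
elim: R a b c => [|R1 IH1 R2 IH2 R3 IH3] a b c abc u v.
  move: abc; rewrite /within_one /center_label.
  case: u => [i|[]]; case: v => [j|[]] /= + _.
  by case: (ord3_cases i) => ->; case: (ord3_cases j) => ->;
    rewrite !inordK //=; lia.
case/or3P => /existsP[u' /existsP[v' /and3P[uv /eqP<- /eqP<-]]].
- rewrite !vdist_place1; apply: IH1 uv; move: abc.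
  by rewrite /within_one /center_label; lia.
- rewrite !vdist_place2; apply: IH2 uv; move: abc.
  by rewrite /within_one /center_label; lia.
- rewrite !vdist_place3; apply: IH3 uv; move: abc.
  by rewrite /within_one /center_label; lia.
Qed.

(** A label is always realised by a path that descends towards the outermost
    vertices: the center sees the smallest of [a], [b], [c]. *)
Lemma idist_pred (R : rans) a b c (s : internal R) :
  exists2 u : vertex R, adj u (inr s) & idist a b c s = (vdist a b c u).+1.
Proof.
elim: R a b c s => [|R1 IH1 R2 IH2 R3 IH3] a b c; first by case.
case=> [[[s|s]|s]|].
- have [u us E] := IH1 (center_label a b c) b c s.
  exists (place1 R2 R3 u); first exact: adj_place1 us.
  by rewrite vdist_place1 -E.
- have [u us E] := IH2 a (center_label a b c) c s.
  exists (place2 R1 R3 u); first exact: adj_place2 us.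
  by rewrite vdist_place2 -E.
- have [u us E] := IH3 a b (center_label a b c) s.
  exists (place3 R1 R2 u); first exact: adj_place3 us.
  by rewrite vdist_place3 -E.
- have [i E] :
      exists i : 'I_3, center_label a b c = (nth 0%N [:: a; b; c] i).+1.
    have [E|[E|E]] : minn a (minn b c) = a \/ minn a (minn b c) = b
                  \/ minn a (minn b c) = c by lia.
    + by exists (inord 0); rewrite inordK // /center_label E.
    + by exists (inord 1); rewrite inordK // /center_label E.
    + by exists (inord 2); rewrite inordK // /center_label E.
  by exists (inl i); [exact: adj_center | exact: E].
Qed.

Lemma at_distance_O1 (R : rans) l (s : internal R) :
  at_distance (@adj R) l (O1 R) (inr s) = (idist 0 1 1 s == l).
Proof.
rewrite (@at_distanceE _ (@adj R) (O1 R) (vdist 0 1 1)) //.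
  by move=> u v; apply: vdist_lip.
case=> [i|t _]; last exact: idist_pred.
move=> i0; exists (O1 R).
  by rewrite adj_outer eq_sym; apply: contraNneq i0 => ->.
move: i0; case: (ord3_cases i) => ->; rewrite /= !inordK //.
by case/eqP; congr inl; apply: val_inj; rewrite /= inordK.
Qed.

(** * Formal power series up to a given degree *)

Section Truncation.
Variables (R : comNzRingType) (n : nat).
Implicit Types (f g : mseries R n) (m : 'X_{1..n}).

Definition eqdeg (N : nat) f g : Prop :=
  forall m, (mdeg m < N)%N -> mscoef f m = mscoef g m.

Lemma eqdeg_all f g : (forall N, eqdeg N f g) -> f = g.
Proof. by move=> fg; apply: mseriesP => m; apply: (fg (mdeg m).+1). Qed.

Lemma eqdegW N f g : eqdeg N.+1 f g -> eqdeg N f g.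
Proof. by move=> fg m lt_m; apply: fg; apply: ltnW. Qed.

Lemma eqdegD N f1 f2 g1 g2 :
  eqdeg N f1 f2 -> eqdeg N g1 g2 -> eqdeg N (f1 + g1) (f2 + g2).
Proof. by move=> ef eg m lt_m; rewrite !mscoefD ef ?eg. Qed.

Lemma eqdegM N f1 f2 g1 g2 :
  eqdeg N f1 f2 -> eqdeg N g1 g2 -> eqdeg N (f1 * g1) (f2 * g2).
Proof. exact: mscoef_eqM. Qed.

Lemma eqdegX N k f g : eqdeg N f g -> eqdeg N (f ^+ k) (g ^+ k).
Proof.
by move=> fg; elim: k => [|k IH]; rewrite ?expr0 // !exprS; apply: eqdegM.
Qed.

Lemma eqdeg_msX N i f g :
  eqdeg N f g -> eqdeg N.+1 (msX i * f) (msX i * g).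
Proof.
move=> fg m lt_m; rewrite !mscoefM; apply: eq_bigr.
case=> -[k1 _] [k2 _] /= /eqP em.
have [k1i|_] := eqVneq k1 U_(i)%MM; last by rewrite !mul0r.
by rewrite fg //; move: lt_m; rewrite em k1i mdegD mdeg1.
Qed.

(** A map that gains one degree of precision determines its fixed point, one
    homogeneous part after the other. *)
Lemma eqdeg_fixpoint_unique (F : mseries R n -> mseries R n) f g :
    (forall N f1 f2, eqdeg N f1 f2 -> eqdeg N.+1 (F f1) (F f2)) ->
  f = F f -> g = F g -> f = g.
Proof.
move=> Fc ef eg; apply: eqdeg_all; elim=> [//|N IH].
by rewrite ef eg; apply: Fc.
Qed.

Definition monomial m : mseries R n := MSeries (fun k => (k == m)%:R).

Lemma monomial0 : monomial 0%MM = 1. Proof. by []. Qed.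

Lemma monomialD m1 m2 : monomial (m1 + m2)%MM = monomial m1 * monomial m2.
Proof.
have agree_monomial N m : agree N (monomial m) 'X_[m].
  by move=> k _; rewrite mcoeffX eq_sym.
apply: agree_eq => N; exists ('X_[m1] * 'X_[m2]).
  by rewrite -mpolyXD; apply: agree_monomial.
by apply: agreeM; apply: agree_monomial.
Qed.

Lemma mscoef_sum (I : Type) (s : seq I) (F : I -> mseries R n) m :
  mscoef (\sum_(i <- s) F i) m = \sum_(i <- s) mscoef (F i) m.
Proof. exact: (big_morph (fun f => mscoef f m)). Qed.

End Truncation.

(** * Counting structures by the profile of their distances *)

Definition ndist (R : rans) (a b c l : nat) : nat :=
  #|[pred s : internal R | idist a b c s == l]|.

Lemma card_pred_option (T : finType) (P : pred (option T)) :
  #|P| = (P None + #|[pred s | P (Some s)]|)%N.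
Proof.
rewrite !cardE /enum_mem -!enumT !size_filter enumT unlock /= count_map.
by rewrite -enumT.
Qed.

Lemma card_pred_sum (T1 T2 : finType) (P : pred (T1 + T2)) :
  #|P| = (#|[pred s | P (inl s)]| + #|[pred s | P (inr s)]|)%N.
Proof. by rewrite -!sum1_card big_sumType. Qed.

Lemma ndist_node (R1 R2 R3 : rans) a b c l :
  let x := center_label a b c in
  ndist (RNode R1 R2 R3) a b c l =
  ((l == x) + ndist R1 x b c l + ndist R2 a x c l + ndist R3 a b x l)%N.
Proof.
move=> x; rewrite /ndist card_pred_option !card_pred_sum /= -/x [x == l]eq_sym.
by rewrite -!addnA.
Qed.

Lemma idistS (R : rans) a b c (s : internal R) :
  idist a.+1 b.+1 c.+1 s = (idist a b c s).+1.
Proof.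
elim: R a b c s => [|R1 IH1 R2 IH2 R3 IH3] a b c; first by case.
have xS : center_label a.+1 b.+1 c.+1 = (center_label a b c).+1.
  by rewrite /center_label !minnSS.
by case=> [[[s|s]|s]|] /=; rewrite xS.
Qed.

Lemma idist_gt0 (R : rans) a b c (s : internal R) : (0 < idist a b c s)%N.
Proof. by have [u _ ->] := idist_pred a b c s. Qed.

Definition profile (d a b c : nat) (R : rans) : 'X_{1..d.+1} :=
  [multinom if i == 0%N :> nat then rans_order R else ndist R a b c i
    | i < d.+1].

Definition level (d x : nat) : 'X_{1..d.+1} :=
  [multinom nat_of_bool (i == x :> nat) | i < d.+1].

Lemma profile_empty d a b c : profile d a b c REmpty = 0%MM.
Proof.
apply/mnmP => i; rewrite mnmE mnm0E; case: eqP => // _.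
by apply: eq_card0 => -[].
Qed.

Lemma profile_node d a b c R1 R2 R3 :
  let x := center_label a b c in
  profile d a b c (RNode R1 R2 R3) =
  (U_(ord0) + level d x + profile d x b c R1 + profile d a x c R2
    + profile d a b x R3)%MM.
Proof.
move=> x; apply/mnmP => i; rewrite !mnmDE mnm1E !mnmE -val_eqE /=.
rewrite [0%N == _]eq_sym; case: (eqVneq (i : nat) 0%N) => [->|_] /=; last first.
  by rewrite ndist_node -/x.
by [].
Qed.

Lemma rans_upto_uniq n : uniq (rans_upto n).
Proof.
elim: n => [//|n IH] /=; apply/andP; split.
  by apply/negP => /allpairsP[[[R1 R2] R3] [_ _]].
apply: allpairs_uniq => //; first by apply: allpairs_uniq => // -[? ?] [? ?].
by move=> [[R1 R2] R3] [[S1 S2] S3] _ _ /= [-> -> ->].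
Qed.

Lemma card_rans_of n N (P : pred rans) : (n <= N)%N ->
  #|[set R : rans_of n | P R]| =
  count (fun R => (rans_order R == n) && P R) (rans_upto N).
Proof.
move=> le_nN; rewrite cardsE cardE -size_filter -(size_map val).
apply: perm_size; apply: uniq_perm.
- by rewrite map_inj_uniq ?enum_uniq //; apply: val_inj.
- by rewrite filter_uniq ?rans_upto_uniq.
move=> R; rewrite mem_filter; apply/mapP/andP => [[S]|[/andP[oR PR] _]].
  rewrite mem_enum unfold_in => PS ->; rewrite PS andbT (valP S); split=> //.
  by apply: mem_rans_upto; rewrite (eqP (valP S)).
by exists (RansOf oR) => //; rewrite mem_enum unfold_in.
Qed.

Definition gser (d a b c : nat) : mseries int d.+1 :=
  MSeries (fun m => #|[set R : rans_of (m ord0) | profile d a b c R == m]|%:Z).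

Lemma mscoef_gser d a b c n (m : 'X_{1..d.+1}) : n = m ord0 ->
  mscoef (gser d a b c) m = #|[set R : rans_of n | profile d a b c R == m]|%:Z.
Proof. by move=> ->. Qed.

(** Sum over the structures of depth at most [n]: unlike a sum over those of
    order at most [n], it satisfies the recursion of the series exactly. *)
Definition psum (d a b c n : nat) : mseries int d.+1 :=
  \sum_(R <- rans_upto n) monomial int (profile d a b c R).

(** A structure of order at most [n] is listed in [rans_upto n], and the order
    is one of the exponents of the profile: the structures left out only affect
    degrees above [n]. *)
Lemma eqdeg_psum d a b c n : eqdeg n.+1 (psum d a b c n) (gser d a b c).
Proof.
move=> m; rewrite ltnS => le_m.
have le_m0 : (m ord0 <= n)%N.
  by apply: leq_trans le_m; rewrite mdegE (bigD1 ord0) //= leq_addr.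
rewrite mscoef_sum /=.
rewrite (card_rans_of (fun R => profile d a b c R == m) le_m0).
elim: (rans_upto n) => [|R s IH]; first by rewrite big_nil.
rewrite big_cons IH /= PoszD; congr (_ + _); rewrite eq_sym.
case: eqP => [<-|_]; last by rewrite andbF.
by rewrite mnmE /= eqxx.
Qed.

Lemma psumS d a b c n :
  let x := center_label a b c in
  psum d a b c n.+1 = 1 + zvar * monomial int (level d x) *
    psum d x b c n * psum d a x c n * psum d a b x n.
Proof.
move=> x; rewrite /psum /= big_cons profile_empty monomial0; congr (_ + _).
rewrite big_allpairs_dep big_allpairs /=.
rewrite [X in _ = X * _ * _]mulr_sumr !mulr_suml; apply: eq_bigr => R1 _.
rewrite [X in _ = X * _]mulr_sumr mulr_suml; apply: eq_bigr => R2 _.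
rewrite mulr_sumr; apply: eq_bigr => R3 _.
by rewrite profile_node !monomialD.
Qed.

(** A non-empty structure is a center with an arbitrary triple of sub-RANS, and
    the labels inside each of them depend on [a], [b], [c] only; hence the
    product. *)
Lemma gser_rec d a b c :
  let x := center_label a b c in
  gser d a b c = 1 + zvar * monomial int (level d x) *
    gser d x b c * gser d a x c * gser d a b x.
Proof.
move=> x; apply: eqdeg_all => N m lt_m.
rewrite -(@eqdeg_psum _ _ _ _ N.+1) ?(ltn_trans lt_m) // psumS -/x.
move: m lt_m; apply: eqdegD => //.
have psumW b1 b2 b3 : eqdeg N (psum d b1 b2 b3 N) (gser d b1 b2 b3).
  by apply: eqdegW; apply: eqdeg_psum.
by do 3![apply: eqdegM; last exact: psumW].
Qed.

Lemma level_uvar d x : (0 < x <= d)%N -> monomial int (level d x) = uvar x.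
Proof.
case/andP=> x0 le_xd; congr monomial.
by apply/mnmP => i; rewrite mnm1E mnmE -val_eqE /= inordK 1?eq_sym.
Qed.

Lemma level_beyond d x : (d < x)%N -> monomial int (level d x) = 1.
Proof.
move=> lt_dx; rewrite -monomial0; congr monomial.
apply/mnmP => i; rewrite mnm0E mnmE; case: eqP => // ix.
by move: (ltn_ord i); rewrite ix ltnS leqNgt lt_dx.
Qed.

Lemma center_labelC a b c : center_label a b c = center_label b a c.
Proof. by rewrite /center_label minnCA. Qed.

Lemma center_labelAC a b c : center_label a b c = center_label a c b.
Proof. by rewrite /center_label [minn b c]minnC. Qed.

(** The symmetries of the triangle exchange the three sub-RANS, which the
    recursion treats alike. *)
Lemma gserC d a b c : gser d a b c = gser d b a c.
Proof.
apply: eqdeg_all => N; elim: N a b c => [//|N IH] a b c.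
rewrite (gser_rec d a b c) (gser_rec d b a c) (center_labelC b a c).
set x := center_label a b c; apply: eqdegD => //.
rewrite -!mulrA [gser d x a c * _]mulrCA.
by apply: eqdeg_msX; do ![apply: eqdegM]; rewrite ?mul1r //; apply: IH.
Qed.

Lemma gserAC d a b c : gser d a b c = gser d a c b.
Proof.
apply: eqdeg_all => N; elim: N a b c => [//|N IH] a b c.
rewrite (gser_rec d a b c) (gser_rec d a c b) (center_labelAC a c b).
set x := center_label a b c; apply: eqdegD => //.
rewrite -!mulrA [gser d a x b * _]mulrC.
by apply: eqdeg_msX; do ![apply: eqdegM]; rewrite ?mul1r //; apply: IH.
Qed.

Lemma gser0 a b c a' b' c' : gser 0 a b c = gser 0 a' b' c'.
Proof.
apply: mseriesP => m /=; congr (Posz #|pred_of_set _|).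
apply/setP => R; rewrite !inE; congr (_ == _).
by apply/mnmP => i; rewrite !mnmE ord1.
Qed.

Lemma profile_shift d a b c R (m : 'X_{1..d.+2}) :
  (profile d.+1 a.+1 b.+1 c.+1 R == m) =
  (m (inord 1) == 0%N) &&
  (profile d a b c R == [multinom m (lift (inord 1) i) | i < d.+1]).
Proof.
have lift1 (i : 'I_d.+1) :
    lift (inord 1) i = (if i == 0 :> nat then 0 else i.+1)%N :> nat.
  by rewrite /= inordK //; case: (i : nat).
have pr1 : profile d.+1 a.+1 b.+1 c.+1 R (inord 1) = 0%N.
  rewrite mnmE inordK //=; apply: eq_card0 => s; rewrite inE idistS eqSS.
  by rewrite eqn0Ngt idist_gt0.
have prS i :
    profile d.+1 a.+1 b.+1 c.+1 R (lift (inord 1) i) = profile d a b c R i.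
  rewrite !mnmE lift1; case: (eqVneq (i : nat) 0%N) => //= _.
  by apply: eq_card => s; rewrite !inE idistS eqSS.
apply/eqP/andP => [<-|[/eqP m1 /eqP/mnmP pm]].
  by rewrite pr1; split => //; apply/eqP/mnmP => i; rewrite [RHS]mnmE prS.
apply/mnmP => i; case: (unliftP (inord 1) i) => [j|] ->; last by rewrite m1.
by rewrite prS pm mnmE.
Qed.

(** When every outermost label is positive, no internal vertex is labelled 1,
    and lowering all labels by one shifts the variables. *)
Lemma gser_shift d a b c : gser d.+1 a.+1 b.+1 c.+1 = shift_u (gser d a b c).
Proof.
apply: mseriesP => m.
have lift0 : lift (inord 1) ord0 = ord0 :> 'I_d.+2.
  by apply: val_inj; rewrite /= inordK.
rewrite [RHS]/=; case: ifP => m1.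
  rewrite (mscoef_gser _ _ _ (erefl (m ord0))).
  have -> : [multinom m (lift (inord 1) i) | i < d.+1] ord0 = m ord0.
    by rewrite mnmE lift0.
  congr (Posz #|pred_of_set _|); apply/setP => R; rewrite !inE.
  by rewrite profile_shift m1.
by congr Posz; apply: eq_card0 => R; rewrite inE profile_shift m1.
Qed.

(** * The functional equations *)

Lemma gser_rec_u d a b c x : center_label a b c = x -> (x <= d)%N ->
  gser d a b c = 1 + zvar * uvar x *
    gser d x b c * gser d a x c * gser d a b x.
Proof. by move=> <- le_xd; rewrite {1}gser_rec level_uvar. Qed.

Lemma gser_system : apollonian_system (fun d => gser d 0 1 1).
Proof.
split=> [||d].
- rewrite {1}gser_rec level_beyond // mulr1 exprS expr2 -!mulrA.
  by rewrite !(gser0 _ _ _ 0 1 1).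
- rewrite {1}(@gser_rec_u 1 0 1 1 1) // (gser_shift 0 0 0 0).
  rewrite (gser0 0 0 0 0 1 1).
  by ring.
(* [C] counts the triangles with one corner at distance 1 and two at distance
   2; [B] those with one corner at distance 2 and two at distance 1. *)
set C := shift_u _; set B := gser d.+2 2 1 1.
have C122 : gser d.+2 1 2 2 = C by apply: (gser_shift d.+1 0 1 1).
have eB : B = 1 + zvar * uvar 2 * B * C ^+ 2.
  rewrite {1}/B (@gser_rec_u _ 2 1 1 2) // [gser _ 2 2 1]gserAC.
  by rewrite [gser _ 2 1 2]gserC C122 -/B; ring.
have -> : 1 / (1 - zvar * uvar 2 * C ^+ 2) ^+ 3 = B ^+ 3.
  rewrite div1r -exprVn; congr (_ ^+ 3); apply: mulr1_eq.
  (* The linear equation for [B] says that [B] is the inverse. *)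
  have B1 : B - zvar * uvar 2 * B * C ^+ 2 = 1 by rewrite {1}eB addrK.
  by rewrite -[RHS]B1; ring.
have -> : 1 + zvar * uvar 2 * B ^+ 3 = gser d.+2 1 1 1.
  rewrite (@gser_rec_u _ 1 1 1 2) // [gser _ 1 1 2]gserAC [gser _ 1 2 1]gserC.
  by rewrite -/B; ring.
by rewrite {1}(@gser_rec_u d.+2 0 1 1 1) //; ring.
Qed.

(** Each equation is a contraction in its unknown once the series of smaller
    index are known. *)
Lemma apollonian_system_unique T1 T2 :
  apollonian_system T1 -> apollonian_system T2 -> forall d, T1 d = T2 d.
Proof.
case=> e10 e11 e1d [e20 e21 e2d].
have eqT0 : T1 0%N = T2 0%N.
  apply: (@eqdeg_fixpoint_unique _ _ (fun h => 1 + zvar * h ^+ 3)) => //.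
  by move=> N f g fg; apply: eqdegD => //; apply: eqdeg_msX; apply: eqdegX.
have main_eq d (A : mseries int d.+1) f g :
    f = 1 + zvar * uvar 1 * f ^+ 2 * A ->
    g = 1 + zvar * uvar 1 * g ^+ 2 * A -> f = g.
  apply: (@eqdeg_fixpoint_unique _ _ (fun h => 1 + zvar * uvar 1 * h ^+ 2 * A)).
  move=> N f1 f2 f12; apply: eqdegD => //; rewrite -!mulrA; apply: eqdeg_msX.
  by do ![apply: eqdegM => //].
elim=> [//|[_|d IH]].
  by apply: (main_eq _ _ _ _ e11); rewrite eqT0; exact: e21.
by apply: (main_eq _ _ _ _ (e1d d)); rewrite IH; exact: e2d.
Qed.

(** [(0, 1, 1)] are the distances of the outermost vertices to the first. *)
Lemma rans_count_gser n d (k : d.-tuple nat) :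
  (rans_count n k)%:Z = mscoef (gser d 0 1 1) [multinom of n :: k].
Proof.
have m0 : [multinom of n :: k] ord0 = n by [].
rewrite (mscoef_gser _ _ _ (esym m0)); congr (Posz #|pred_of_set _|).
apply/setP => R; rewrite !inE.
have nd (l : nat) :
    #|[set v : internal R | at_distance (@adj R) l (O1 R) (inr v)]|
    = ndist R 0 1 1 l.
  by rewrite cardsE; apply: eq_card => v; exact: at_distance_O1.
apply/forallP/eqP => [dk|/mnmP pk j].
  apply/mnmP => i; rewrite mnmE; case: (unliftP ord0 i) => [j|] ->.
    by rewrite /= -nd (eqP (dk j)) mnm_tnth tnthS.
  by rewrite /= m0; apply/eqP/(valP R).
by have := pk (lift ord0 j); rewrite mnmE /= -nd mnm_tnth tnthS => ->.
Qed.

Theorem proposition3p1 :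
  (exists T : forall d : nat, mseries int d.+1, apollonian_system T) /\
  forall T : forall d : nat, mseries int d.+1, apollonian_system T ->
  forall (d n : nat) (k : d.-tuple nat), (1 <= d)%N ->
    (rans_count n k)%:Z = mscoef (T d) [multinom of n :: k].
Proof.
split; first by exists (fun d => gser d 0 1 1); apply: gser_system.
move=> T sysT d n k _.
by rewrite rans_count_gser (apollonian_system_unique sysT gser_system).
Qed.
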